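(* Let $G$ be a finitely generated group and let $\pi:G\to O(\mathcal{H})$ be an orthogonal representation in a real Hilbert space without almost-invariant vectors. Let $l:G\to\mathcal{H}$ be a cocycle for $\pi$. Then there are constants $C_1,C_2(l)>0$ such that for any finite $A\subset G$ and any $x\in A$, $$\mathrm{dist}_{\mathcal{H}}\big(l(x),\overline{\mathrm{conv}}\,(l(\partial_{C_1}A))\big)\le C_2 .$$
   Context: $G$ is equipped with a left-invariant word metric $\rho$ coming from a finite generating set. For finite $A\subset G$ and $C>0$: $\mathrm{int}_C(A)=\{x:\ \rho(x,y)<C\Rightarrow y\in A\}$ and $\partial_C(A)=A\setminus\mathrm{int}_C(A)$. A cocycle satisfies $l(gh)=\pi(g)l(h)+l(g)$. Almost-invariant vectors: a sequence $v_j$ with $\|v_j\|=1$ and $\|\pi(g)v_j-v_j\|\to0$ for every $g\in G$. $\overline{\mathrm{conv}}$ is the closed convex hull.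
   Formalization: The finite set A is assumed different from G; this is automatic for infinite G, and for finite G with A = G the boundary is empty, so the distance to its closed convex hull is undefined (e.g. G = Z/2 with the sign representation). *)

(* Defs.v *)
From HB Require Import structures.
From mathcomp Require Import all_boot all_order all_algebra.
From mathcomp Require Import all_classical all_reals all_analysis.

Set Implicit Arguments.
Unset Strict Implicit.
Unset Printing Implicit Defensive.

Import Order.TTheory GRing.Theory Num.Theory.
Import numFieldNormedType.Exports.

Local Open Scope classical_set_scope.
Local Open Scope ring_scope.

(* A real Hilbert space is a complete normed space H together with an inner
   product [dot] inducing its norm. *)
Definition induces_norm (R : realType) (H : completeNormedModType R)
    (dot : {dot H for idfun}) :=
  forall v : H, `|v| ^+ 2 = dot v v.

Section WordMetric.
Variables (R : realType) (G : groupType) (S : set G).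

Definition words : set (seq G) :=
  [set w | forall s, s \in w -> S s \/ S (s^-1)%g].

Definition words_for (g : G) : set (seq G) :=
  [set w | words w /\ (\prod_(s <- w) s)%g = g].

Definition generates := forall g : G, words_for g !=set0.

(* The infimum, attained at a natural number, is the usual word length when S
   generates G. *)
Definition word_length (g : G) : R :=
  inf [set (size w)%:R | w in words_for g].

Definition word_dist (x y : G) : R := word_length (x^-1 * y)%g.

Definition int_ (C : R) (A : set G) : set G :=
  [set x | forall y, word_dist x y < C -> A y].

Definition boundary (C : R) (A : set G) : set G := A `\` int_ C A.

End WordMetric.

Section Representation.
Variables (R : realType) (G : groupType) (H : completeNormedModType R).
Variable (dot : {dot H for idfun}).

(* Surjectivity of each pi g, required for membership in O(H), follows from
   the first two clauses. *)
Definition orthogonal_representation (pi : G -> {linear H -> H}) :=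
  [/\ forall v, pi 1%g v = v,
      forall g h v, pi (g * h)%g v = pi g (pi h v)
    & forall g u v, dot (pi g u) (pi g v) = dot u v].

Definition has_almost_invariant_vectors (pi : G -> {linear H -> H}) :=
  exists v : nat -> H, (forall j, `|v j| = 1) /\
    forall g, `|pi g (v j) - v j| @[j --> \oo] --> (0 : R).

Definition cocycle (pi : G -> {linear H -> H}) (l : G -> H) :=
  forall g h, l (g * h)%g = pi g (l h) + l g.

End Representation.

Definition closed_conv (R : realType) (H : completeNormedModType R)
    (B : set H) : set H :=
  smallest [set K : set H | closed K /\ convex_set K] B.

(* Main.v *)
Require Import Defs.
From mathcomp Require Import all_boot all_order all_algebra.
From mathcomp Require Import all_classical all_reals all_analysis.
Import Order.TTheory GRing.Theory Num.Theory.
Import numFieldNormedType.Exports.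
Local Open Scope classical_set_scope.
Local Open Scope ring_scope.

(** Perturb [l] by a coboundary so that it becomes harmonic, and then use the
    maximum principle.

    Let [W] list the generators and their inverses, and let [T] be [W] together
    with the identity. Since [pi] has no almost-invariant vectors, each nonzero
    vector is moved by some element of [W] by a definite proportion of its
    length ([spectral_gap]). The identity being in [T], the sum of [pi t v]
    over [T] contains a pair [v + pi s v] whose norm is at most a fixed
    multiple of [`|v|], smaller than [2 * `|v|], by the parallelogram law, so
    the averaging operator [M v = mean T (pi ^~ v)] has norm less than 1
    ([lazy_sum_contracts]). Hence [v = M v + mean T l] has a solution [v]
    ([exists_mean_zero_correction]), which means that the cocycle [h g = l g -
    (v - pi g v)] has mean zero over [T]. As [h (y * t) = pi y (h t) + h y], it
    is harmonic: [h y] is the mean of its values at the points [y * t]. It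
    differs from [l] by at most [2 * `|v|].

    Let [B] be the boundary of [A] and [K] the closed convex hull of [l @` B].
    The distance to a convex set is a convex function, so
    [phi y = set_dist K (h y)] is subharmonic, and [phi <= 2 * `|v|] on [B].
    A point of [A] outside [B] has all its neighbours in [A]; thus, if the
    maximum of [phi] over the finite set [A] were larger than [2 * `|v|], the
    set where it is attained would be stable under right multiplication by
    generators and would be all of [G], against [A <> setT]. So
    [phi <= 2 * `|v|] on [A] ([subharmonic_max_principle]). Going back from [h]
    to [l] costs [2 * `|v|] more, and [C2 = 4 * `|v| + 1] works, the 1 absorbing
    the fact that the distance to [K] is only an infimum. Neighbours are at
    distance at most 1, so any [C1 > 1] would do; the proof takes [C1 = 2]. *)

(** * Means and the distance to a convex set *)

Definition mean {R : realType} {V : lmodType R} {I : Type} (T : seq I)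
    (F : I -> V) : V := (size T)%:R^-1 *: \sum_(t <- T) F t.

Definition set_dist {R : realType} {V : normedModType R} (K : set V) (p : V)
  : R := inf [set `|p - k| | k in K].

Lemma sumr_const_size {R : realType} {I : Type} (T : seq I) (c : R) :
  \sum_(t <- T) c = (size T)%:R * c.
Proof. by rewrite big_const_seq count_predT iter_addr_0 mulr_natl. Qed.

Lemma convex_set_segment {R : realType} {V : lmodType R} (K : set V)
    (t : R) (x y : V) :
  convex_set K -> 0 <= t <= 1 -> K x -> K y -> K (t *: x + (1 - t) *: y).
Proof.
move=> cK /andP[t0 t1] Kx Ky.
have := cK x y (Itv01 t0 t1).
by rewrite !inE => /(_ Kx Ky).
Qed.

Lemma convex_mean {R : realType} {V : lmodType R} {I : eqType} (T : seq I)
    (F : I -> V) (K : set V) :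
  convex_set K -> (0 < size T)%N -> (forall t, t \in T -> K (F t)) ->
  K (mean T F).
Proof.
move=> cK; case: T => [//|a T] _; elim: T a => [|b T IH] a KF.
  rewrite /mean big_cons big_nil addr0 invr1 scale1r.
  by apply: KF; rewrite mem_head.
(* Adding a point to a family of n points is a convex combination of the new
   point, with weight 1 / (n + 1), and of the previous mean. *)
have -> : mean [:: a, b & T] F =
    (size T).+2%:R^-1 *: F a + (1 - (size T).+2%:R^-1) *: mean (b :: T) F.
  rewrite /mean big_cons scalerDr scalerA /=; congr (_ + _).
  have N0 : (size T).+2%:R != 0 :> R by rewrite pnatr_eq0.
  have -> : 1 - (size T).+2%:R^-1 = (size T).+1%:R / (size T).+2%:R :> R.
    apply: (mulIf N0); rewrite mulrBl mul1r mulVf // mulfVK //.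
    by rewrite -[X in X - 1]natr1 addrK.
  by rewrite mulrAC mulfV ?pnatr_eq0 // mul1r.
apply: convex_set_segment => //.
- by rewrite invr_ge0 ler0n invf_le1 ?ler1n ?ltr0n.
- by apply: KF; rewrite mem_head.
- by apply: IH => t tT; apply: KF; rewrite inE tT orbT.
Qed.

Lemma set_dist_le {R : realType} {V : normedModType R} (K : set V) (p k : V) :
  K k -> set_dist K p <= `|p - k|.
Proof.
move=> Kk; apply: ge_inf; last by exists k.
by exists 0 => _ [y _ <-].
Qed.

Lemma set_dist_adherent {R : realType} {V : normedModType R} (K : set V) (r : R)
    (p : V) :
  K !=set0 -> set_dist K p < r -> exists2 k, K k & `|p - k| < r.
Proof.
move=> [k0 Kk0] pr; have e0 : 0 < r - set_dist K p by rewrite subr_gt0.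
have [|_ [k Kk <-]] := inf_adherent e0 (E := [set `|p - k| | k in K]).
  by split; [exists `|p - k0|, k0 | exists 0 => _ [y _ <-]].
by rewrite subrKC => ?; exists k.
Qed.

(** Jensen's inequality for the distance to a convex set: the mean of nearly
    closest points of [K] is itself in [K]. *)
Lemma set_dist_mean {R : realType} {V : normedModType R} {I : eqType}
    (T : seq I) (F : I -> V) (K : set V) :
  convex_set K -> K !=set0 -> (0 < size T)%N ->
  (size T)%:R * set_dist K (mean T F) <= \sum_(t <- T) set_dist K (F t).
Proof.
move=> cK K0 T0; have n0 : 0 < (size T)%:R :> R by rewrite ltr0n.
rewrite -ler_pdivlMl//; apply/ler_addgt0Pr => e e0.
have /choice[k kP] : forall t, exists y,
    K y /\ `|F t - y| < set_dist K (F t) + e.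
  move=> t; have [|y] := set_dist_adherent K (set_dist K (F t) + e) (F t) K0.
    by rewrite ltrDl.
  by exists y.
apply: (le_trans (set_dist_le K _ (mean T k) _)).
  by apply: convex_mean => // t _; exact: (kP t).1.
rewrite -scalerBr -sumrB normrZ ger0_norm ?invr_ge0 ?ler0n//.
rewrite -ler_pdivlMl ?invr_gt0// invrK mulrDr mulrA divff ?gt_eqF// mul1r.
apply: (le_trans (ler_norm_sum _ _ _)).
by rewrite -sumr_const_size -big_split; apply: ler_sum => t _;
  exact: ltW (kP t).2.
Qed.

(** * Harmonic functions on a finitely generated group *)

Lemma generates_right_closed {G : groupType} (S Z : set G) :
  generates S -> Z !=set0 ->
  (forall y s, Z y -> S s \/ S (s^-1)%g -> Z (y * s)%g) -> Z = setT.
Proof.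
move=> Sgen [y0 Zy0] Zclosed; apply/seteqP; split=> // g _.
have [w [wS wE]] := Sgen (y0^-1 * g)%g.
rewrite -(mulVKg y0 g) -{}wE.
elim: w y0 Zy0 wS => [|s w IH] y Zy wS; first by rewrite big_nil mulg1.
rewrite big_cons mulgA; apply: IH.
  by apply: Zclosed => //; apply: wS; rewrite mem_head.
by move=> t tw; apply: wS; rewrite inE tw orbT.
Qed.

Lemma finite_set_argmax {R : realType} {X : choiceType} (A : set X)
    (phi : X -> R) :
  finite_set A -> A !=set0 -> exists2 y, A y & forall x, A x -> phi x <= phi y.
Proof.
move=> /finite_seqP[s ->] [x0 xs]; rewrite /= in xs *.
have : s != [::] by case: s xs.
elim: s {xs} => [//|a s IH] _; case: (eqVneq s [::]) => [->|/IH[y ys ymax]].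
  by exists a => [|x]; rewrite ?mem_head// inE => /eqP ->.
have [ya|ay] := leP (phi y) (phi a).
  exists a => [|x]; first by rewrite mem_head.
  by rewrite inE => /orP[/eqP -> //|/ymax xy]; exact: le_trans xy ya.
exists y => [|x]; first by rewrite inE ys orbT.
by rewrite inE => /orP[/eqP ->|/ymax //]; exact: ltW.
Qed.

Lemma sum_max_eq {R : realType} {I : eqType} (T : seq I) (F : I -> R) (m : R) :
  (forall t, t \in T -> F t <= m) -> (size T)%:R * m <= \sum_(t <- T) F t ->
  forall t, t \in T -> F t = m.
Proof.
move=> Fm mF t tT; apply/eqP; rewrite eq_le Fm //= leNgt; apply/negP => Ftm.
move: mF; rewrite leNgt => /negP; apply.
rewrite -sumr_const_size !(big_rem t tT) /= ltr_leD // big_seq [leRHS]big_seq.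
by apply: ler_sum => u /mem_rem; exact: Fm.
Qed.

(** Outside [B] the value of [phi] is at most the mean of its values at the
    neighbours, so a maximum larger than [c] spreads to all neighbours, hence to
    the whole group, which contradicts [A <> setT]. *)
Lemma subharmonic_max_principle {R : realType} {G : groupType} (S : set G)
    (T : seq G) (A B : set G) (phi : G -> R) (c : R) :
  generates S -> (forall s, S s \/ S (s^-1)%g -> s \in T) ->
  finite_set A -> A <> setT ->
  (forall y t, A y -> ~ B y -> t \in T -> A (y * t)%g) ->
  (forall y, A y -> ~ B y ->
    (size T)%:R * phi y <= \sum_(t <- T) phi (y * t)%g) ->
  (forall y, B y -> phi y <= c) ->
  forall x, A x -> phi x <= c.
Proof.
move=> Sgen ST finA AnT Aint sub phiB x Ax.
have [y Ay ymax] := finite_set_argmax A phi finA (ex_intro _ x Ax).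
apply: (le_trans (ymax _ Ax)); rewrite leNgt; apply/negP => cy.
pose Z := [set z | A z /\ phi z = phi y].
suff ZT : Z = setT.
  by apply: AnT; apply/seteqP; split=> // z _; have [] : Z z by rewrite ZT.
apply: (generates_right_closed _ _ Sgen); first by exists y.
move=> z s [Az zy] /ST sT.
have nBz : ~ B z by move=> /phiB; rewrite zy leNgt cy.
split; first exact: Aint.
apply: (sum_max_eq T (fun t => phi (z * t)%g)) => //.
  by move=> t tT; apply: ymax; exact: Aint.
by rewrite -zy; exact: sub.
Qed.

(** * Orthogonal representations with a spectral gap *)

Section Orthogonal.
Context {R : realType} {G : groupType} {H : completeNormedModType R}.
Context (dot : {dot H for idfun}) (dot_norm : induces_norm dot).
Context (pi : G -> {linear H -> H}).
Hypothesis pi_orthogonal : orthogonal_representation dot pi.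

Lemma norm_orthogonal g v : `|pi g v| = `|v|.
Proof.
have [_ _ piO] := pi_orthogonal.
by apply/eqP; rewrite -(@eqrXn2 _ 2) // !dot_norm piO.
Qed.

Lemma parallelogram (u v : H) :
  `|u + v| ^+ 2 + `|u - v| ^+ 2 = (`|u| ^+ 2 + `|v| ^+ 2) *+ 2.
Proof.
rewrite !dot_norm !linearDl !linearDr !linearNl !linearNr opprK addrACA.
rewrite [X in X + _]addrACA subrr addr0 [X in _ + X]addrACA subrr add0r.
by rewrite mulr2n addrACA.
Qed.

(** Uniform convexity: by the parallelogram law
    [`|u + v| ^+ 2 <= (4 - e ^+ 2) * `|u| ^+ 2], and the bound follows from
    [4 - e ^+ 2 <= (2 - e ^+ 2 / 4) ^+ 2]. *)
Lemma norm_add_le_of_norm_sub_ge (u v : H) (e : R) :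
  `|v| = `|u| -> 0 <= e <= 1 -> e * `|u| <= `|v - u| ->
  `|u + v| <= (2 - e ^+ 2 / 4) * `|u|.
Proof.
move=> vu /andP[e0 e1] eu.
have e2 : e ^+ 2 <= 1 by rewrite expr_le1.
have c0 : 0 <= 2 - e ^+ 2 / 4.
  rewrite subr_ge0 ler_pdivrMr // (le_trans e2)//.
  by rewrite -natrM ler1n.
rewrite -(@ler_pXn2r _ 2) ?nnegrE ?mulr_ge0 //.
have -> : `|u + v| ^+ 2 = 4 * `|u| ^+ 2 - `|v - u| ^+ 2.
  apply/(canRL (addrK _)); rewrite distrC parallelogram vu.
  by rewrite -mulr2n -mulrnA mulr_natl.
rewrite exprMn lerBlDr -lerBlDl -mulrBl.
apply: (@le_trans _ _ ((e * `|u|) ^+ 2)); last first.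
  by rewrite ler_pXn2r ?nnegrE ?mulr_ge0.
rewrite exprMn ler_wpM2r ?exprn_ge0 // sqrrB.
have -> : 2 * (e ^+ 2 / 4) *+ 2 = e ^+ 2.
  by rewrite -mulrnAl -[2 *+ 2]mulr_natr -natrM mulrCA mulfV ?mulr1.
have -> : 2 ^+ 2 = 4 :> R by rewrite -natrX.
by rewrite lerBlDr addrA subrKC lerDl sqr_ge0.
Qed.

(** Split the displacement from [v] to [pi (s1 * s2 * ...) v] into successive
    steps, one for each letter; the prefix in front of a letter acts
    isometrically and does not change the length of its step. *)
Lemma displacement_word (w : seq G) (v : H) (e : R) :
  (forall s, s \in w -> `|pi s v - v| <= e) ->
  `|pi (\prod_(s <- w) s)%g v - v| <= (size w)%:R * e.
Proof.
have [pi1 piM _] := pi_orthogonal.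
elim: w => [|s w IH] we; first by rewrite big_nil pi1 subrr normr0 mul0r.
rewrite big_cons piM -[_ - v](subrKA (pi s v)) -linearB.
rewrite (le_trans (ler_normD _ _)) //= norm_orthogonal -natr1 mulrDl mul1r.
apply: lerD; last by apply: we; rewrite mem_head.
by apply: IH => t tw; apply: we; rewrite inE tw orbT.
Qed.

(** If unit vectors [v j] are moved by less than [1 / (j + 1)] by every
    generator, they are moved by at most [size w / (j + 1)] by a word [w], so
    they form a sequence of almost-invariant vectors. *)
Lemma spectral_gap (S : set G) :
  generates S -> ~ has_almost_invariant_vectors pi ->
  exists2 e : R, 0 < e <= 1 & forall v, v != 0 ->
    exists2 s, S s \/ S (s^-1)%g & e * `|v| <= `|pi s v - v|.
Proof.
move=> Sgen nai; apply: contrapT => ngap; apply: nai.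
have /choice[v vP] : forall j : nat, exists v : H, `|v| = 1 /\
    forall s, S s \/ S (s^-1)%g -> `|pi s v - v| < j.+1%:R^-1.
  move=> j; apply: contrapT => nv; apply: ngap; exists j.+1%:R^-1.
    by rewrite invr_gt0 ltr0n invf_le1 ?ler1n ?ltr0n.
  move=> v v0; apply: contrapT => ns; apply: nv; exists (`|v|^-1 *: v).
  have v_gt0 : 0 < `|v| by rewrite normr_gt0.
  split=> [|s Ss]; first by rewrite normrZ normfV normr_id mulVf ?gt_eqF.
  rewrite linearZ -scalerBr normrZ normfV normr_id ltr_pdivrMl // mulrC.
  by rewrite ltNge; apply/negP => es; apply: ns; exists s.
exists v; split=> [j|g]; first exact: (vP j).1.
have [w [wS <-]] := Sgen g.
apply: (@squeeze_cvgr _ _ _ _ (fun=> 0) (fun j => (size w)%:R * harmonic j)).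
- near=> j; rewrite normr_ge0 /=; apply: displacement_word => s /wS Ss.
  exact/ltW/(vP j).2.
- exact: cvg_cst.
- by rewrite -[0](mulr0 (size w)%:R); apply: cvgMr; exact: cvg_harmonic.
Unshelve. all: by end_near. Qed.

(** Without the identity in the list the norm need not drop: if [s] acts as
    [-1], then averaging over [s] alone is an isometry. With it, the vector [v]
    and its displaced image [pi s v] partly cancel. *)
Lemma lazy_sum_contracts (W : seq G) (e : R) (v : H) :
  0 <= e <= 1 -> (exists2 s, s \in W & e * `|v| <= `|pi s v - v|) ->
  `|\sum_(t <- 1%g :: W) pi t v| <= ((size W).+1%:R - e ^+ 2 / 4) * `|v|.
Proof.
move=> e01 [s sW es]; have [pi1 _ _] := pi_orthogonal.
rewrite big_cons pi1 (big_rem s sW) /= addrA.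
apply: (le_trans (ler_normD _ _)).
have -> : (size W).+1%:R = 2 + (size (rem s W))%:R :> R.
  by rewrite size_rem // -natrD add2n prednK //; case: W sW {es}.
rewrite addrAC mulrDl; apply: lerD.
  by apply: norm_add_le_of_norm_sub_ge => //; exact: norm_orthogonal.
apply: (le_trans (ler_norm_sum _ _ _)).
under eq_bigr do rewrite norm_orthogonal.
by rewrite sumr_const_size.
Qed.

(** The unknown [v] is the fixed point of an affine map whose linear part is the
    mean of the [pi t], a contraction. With [b] the sum of [l t], the
    conclusion says that [l t - (v - pi t v)] sums to zero. *)
Lemma exists_mean_zero_correction (W : seq G) (e : R) (b : H) :
  0 < e <= 1 ->
  (forall v, v != 0 -> exists2 s, s \in W & e * `|v| <= `|pi s v - v|) ->
  exists v, \sum_(t <- 1%g :: W) pi t v + b = (size W).+1%:R *: v.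
Proof.
move=> /andP[e0 e1] gap; set n : R := (size W).+1%:R.
have n0 : 0 < n by rewrite ltr0n.
pose f (v : H) := n^-1 *: (\sum_(t <- 1%g :: W) pi t v + b).
pose q := (n - e ^+ 2 / 4) / n.
have d0 : 0 < e ^+ 2 / 4 by rewrite divr_gt0 ?exprn_gt0.
have q0 : 0 <= q.
  rewrite divr_ge0 ?(ltW n0) // subr_ge0 ler_pdivrMr //.
  apply: (@le_trans _ _ 1); first by rewrite expr_le1 // ltW.
  by rewrite -natrM ler1n.
have q1 : q < 1 by rewrite ltr_pdivrMr // mul1r gtrBl.
have ctr : is_contraction [fun of totalfun f : H -> H].
  exists (NngNum q0); split=> //= -[x y] _ /=.
  rewrite /totalfun_ /f -scalerBr opprD addrACA subrr addr0 -sumrB.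
  under eq_bigr do rewrite -linearB.
  rewrite normrZ ger0_norm ?invr_ge0 ?(ltW n0) // /q mulrAC [leRHS]mulrC.
  rewrite ler_wpM2l ?invr_ge0 ?(ltW n0) //.
  have [->|xy0] := eqVneq (x - y) 0.
    by under eq_bigr do rewrite linear0; rewrite big1 ?normr0 ?mulr0.
  by apply: lazy_sum_contracts; [rewrite (ltW e0) | exact: gap].
have [] := banach_fixed_point ctr; [exact: closedT | by exists 0 |].
move=> v _ vE; exists v; rewrite [in RHS]vE /= /totalfun_ /f.
by rewrite scalerA mulfV ?scale1r // gt_eqF.
Qed.

Lemma cocycle_sub_coboundary (l : G -> H) (v : H) :
  cocycle pi l -> cocycle pi (fun g => l g - (v - pi g v)).
Proof.
move=> lc g h; have [_ piM _] := pi_orthogonal.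
rewrite lc piM !(linearB (pi g)) /= [RHS]addrACA -[in RHS]opprD.
by congr (_ - _); rewrite [RHS]addrC subrKA.
Qed.

Lemma coboundary_bounded (v : H) g : `|v - pi g v| <= 2 * `|v|.
Proof.
rewrite (le_trans (ler_normB _ _)) // norm_orthogonal.
by rewrite -mulr2n mulr_natl.
Qed.

Lemma cocycle_mean_value (T : seq G) (l : G -> H) (y : G) :
  cocycle pi l -> (0 < size T)%N -> \sum_(t <- T) l t = 0 ->
  mean T (fun t => l (y * t)%g) = l y.
Proof.
move=> lc T0 lT; rewrite /mean.
under eq_bigr do rewrite lc.
rewrite big_split /= -linear_sum lT linear0 add0r.
rewrite big_const_seq count_predT iter_addr_0 -[l y *+ _]scaler_nat scalerA.
by rewrite mulVf ?scale1r // pnatr_eq0 -lt0n.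
Qed.

End Orthogonal.

(** * Word metric, boundaries and the main estimate *)

Lemma word_dist_letter {R : realType} {G : groupType} (S : set G) (x s : G) :
  S s \/ S (s^-1)%g -> word_dist R S x (x * s)%g <= 1.
Proof.
move=> Ss; rewrite /word_dist mulKg; apply: ge_inf.
  by exists 0 => _ [w _ <-].
exists [:: s] => //; split; last by rewrite big_seq1.
by move=> t; rewrite inE => /eqP ->.
Qed.

Lemma boundary_closed_step {R : realType} {G : groupType} (S : set G) (C : R)
    (A : set G) (y s : G) :
  1 < C -> S s \/ S (s^-1)%g -> A y -> ~ boundary S C A y -> A (y * s)%g.
Proof.
move=> C1 Ss Ay nBy; have : int_ S C A y.
  by apply: contrapT => nIy; apply: nBy.
by apply; exact: le_lt_trans (word_dist_letter S y s Ss) C1.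
Qed.

Lemma closed_conv_convex {R : realType} {H : completeNormedModType R}
    (B : set H) : convex_set (closed_conv B).
Proof.
move=> x y t; rewrite !inE => Bx By K [[clK cK] BK].
have := cK x y t; rewrite !inE; apply.
  exact: (Bx _ (conj (conj clK cK) BK)).
exact: (By _ (conj (conj clK cK) BK)).
Qed.

Lemma finite_letters {G : groupType} (S : set G) : finite_set S ->
  exists W : seq G, forall s, S s \/ S (s^-1)%g <-> s \in W.
Proof.
move=> /finite_seqP[U ->]; exists (U ++ [seq (u^-1)%g | u <- U]) => s.
rewrite /= mem_cat -[s in X in _ <-> is_true (_ || X)](invgK s).
by rewrite (mem_map invg_inj); apply: rwP; exact: orP.
Qed.

Theorem theorem2p2 (R : realType) (G : groupType) (S : set G)
    (S_finite : finite_set S) (S_generates : generates S)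
    (H : completeNormedModType R) (dot : {dot H for idfun})
    (dot_norm : induces_norm dot)
    (pi : G -> {linear H -> H})
    (pi_orthogonal : orthogonal_representation dot pi)
    (pi_no_almost_invariant : ~ has_almost_invariant_vectors pi) :
  exists C1 : R, 0 < C1 /\
    forall l : G -> H, cocycle pi l ->
    exists C2 : R, 0 < C2 /\
      forall A : set G, finite_set A -> A <> setT ->
      forall x : G, A x ->
        (edist_inf (closed_conv (l @` boundary S C1 A)) (l x) <= C2%:E)%E.
Proof.
exists 2; split=> // l lc.
have [e e01 gap] := spectral_gap dot dot_norm pi pi_orthogonal
  S S_generates pi_no_almost_invariant.
have [W WE] := finite_letters S S_finite.
have {}gap u : u != 0 -> exists2 s, s \in W & e * `|u| <= `|pi s u - u|.
  by move=> /gap[s /WE sW us]; exists s.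
pose T := 1%g :: W.
have [v vE] := exists_mean_zero_correction dot dot_norm pi pi_orthogonal
  W e (\sum_(t <- T) l t) e01 gap.
pose h g := l g - (v - pi g v).
have hc : cocycle pi h by exact: (cocycle_sub_coboundary dot).
have hT : \sum_(t <- T) h t = 0.
  rewrite !sumrB big_const_seq count_predT iter_addr_0 -[v *+ _]scaler_nat.
  by rewrite -vE -/T addrAC subrr add0r subrr.
have hl g : `|l g - h g| <= 2 * `|v|.
  by rewrite subKr; exact: (coboundary_bounded dot).
exists (4 * `|v| + 1); split; first by rewrite ltr_wpDl ?mulr_ge0.
move=> A finA AnT x Ax; set B := boundary S 2 A; set K := closed_conv _.
have step y s : A y -> ~ B y -> s \in W -> A (y * s)%g.
  move=> Ay nBy /WE Ss.
  exact: (@boundary_closed_step R G S 2 A y s (ltr1n R 2)).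
have BK y : B y -> K (l y) by move=> By; apply: sub_gen_smallest; exists y.
(* Needed because the real infimum [set_dist] of the empty set is 0. *)
have [b Bb] : B !=set0.
  apply: contrapT => nB; apply: AnT.
  apply: (generates_right_closed _ _ S_generates); first by exists x.
  by move=> y s Ay /WE sW; apply: step => // By; apply: nB; exists y.
have K0 : K !=set0 by exists (l b); exact: BK.
have hK : set_dist K (h x) <= 2 * `|v|.
  apply: (subharmonic_max_principle S T A B (set_dist K \o h)) => //.
  - by move=> s /WE sW; rewrite inE sW orbT.
  - move=> y t Ay nBy; rewrite inE => /orP[/eqP ->|]; first by rewrite mulg1.
    exact: step.
  - move=> y _ _ /=.
    have := set_dist_mean T (fun t => h (y * t)%g) K
      (closed_conv_convex _) K0 isT.
    by rewrite (cocycle_mean_value pi).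
  (* On the boundary, [l y] itself is the point of [K] to compare with. *)
  - move=> y By /=; apply: (le_trans (set_dist_le _ _ _ (BK _ By))).
    by rewrite distrC.
have [k Kk hk] : exists2 k, K k & `|h x - k| < 2 * `|v| + 1.
  by apply: set_dist_adherent => //; rewrite (le_lt_trans hK) // ltrDl.
apply: (@le_trans _ _ (edist (l x, k))).
  by apply: ereal_inf_lbound; exists k.
apply: edist_fin; first by rewrite ltr_wpDl ?mulr_ge0.
rewrite -ball_normE /= -(subrKA (h x)) (le_lt_trans (ler_normD _ _)) //.
have -> : 4 * `|v| + 1 = 2 * `|v| + (2 * `|v| + 1).
  by rewrite addrA -mulrDl -natrD.
exact: ler_ltD.
Qed.
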